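(* (1) There are precisely four $\mathbb{Z}$-points on $V(2)_{0,3}$. They are $$(x_1,x_2,x_3)=\pm(1,1,0),\ \pm(3,-1,2).$$ (2) There are exactly two $\mathbb{Z}$-PCFs for $\sqrt2$ of type $(0,3)$. They are $\sqrt2=[\overline{3,-1,2}]$ and $\sqrt2=[\overline{1,1,0}]$. The latter is equivalent to the classical $\sqrt2=[1,\overline{2}]$ via the formal identity $[\ldots,a,0,b,\ldots]=[\ldots,a+b,\ldots]$.
   Context: The PCF variety $V(2)_{0,3}\subseteq\mathbb{A}^3$, associated with the polynomial $x^2-2$, is defined, with $D(c)=\begin{bmatrix}c&1\\1&0\end{bmatrix}$ and $\begin{bmatrix}E_{11}&E_{12}\\ E_{21}&E_{22}\end{bmatrix}=D(x_1)D(x_2)D(x_3)$, by $A(E_{22}-E_{11})=BE_{21}$, $-AE_{12}=CE_{21}$, $-BE_{12}=C(E_{22}-E_{11})$ for $(A,B,C)=(1,0,-2)$; explicitly, $$x_2-x_1x_2x_3-x_1-x_3=0,\qquad -x_1x_2-1=-2(x_2x_3+1).$$ A $\mathbb{Z}$-PCF of type $(0,3)$ for $\sqrt2$ is a periodic continued fraction $[\overline{a_1,a_2,a_3}]$, with $a_1,a_2,a_3\in\mathbb{Z}$, whose value is $\sqrt2$. Here the partial quotients $c_1,c_2,\ldots$ are $a_1,a_2,a_3,a_1,a_2,a_3,\ldots$; the $n$-th convergent is $M_{11}/M_{21}\in\mathbb{P}^1(\mathbb{C})$ with $M=D(c_1)\cdots D(c_n)$, and the value is the limit of the convergents in $\mathbb{P}^1(\mathbb{C})$,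 if it exists. A continued fraction with a zero partial quotient, $[\ldots,a,0,b,\ldots]$, has the same value (if any) as $[\ldots,a+b,\ldots]$, and one writes equality between them. *)

(* Defs.v *)
From mathcomp Require Import all_boot all_order all_algebra.
From mathcomp Require Import complex.
From mathcomp Require Import all_classical all_reals all_analysis.
From mathcomp Require Import ring.

Set Implicit Arguments.
Unset Strict Implicit.
Unset Printing Implicit Defensive.

Import Order.TTheory GRing.Theory Num.Theory numFieldNormedType.Exports.

Local Open Scope classical_set_scope.
Local Open Scope ring_scope.
Local Open Scope complex_scope.

Definition Dmx (A : comNzRingType) (c : A) : 'M[A]_2 :=
  \matrix_(i, j) if (i == 0) && (j == 0) then c else (i != j)%:R.

Definition cf_mx (A : comNzRingType) (c : nat -> A) (n : nat) : 'M[A]_2 :=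
  \prod_(i < n) Dmx (c i).

(* Partial quotients, indexed from 0, of the periodic continued fraction
   [b_1, ..., b_N, \overline{a_1, ..., a_k}] of type (N, k), where
   b = [:: b_1; ...; b_N] and a = [:: a_1; ...; a_k] with k >= 1. *)
Definition pcf (A : nmodType) (b a : seq A) (n : nat) : A :=
  if (n < size b)%N then b`_n else a`_((n - size b) %% size a).

(* The A-points of the PCF variety of type (0, 3) attached to the quadratic
   a x^2 + b x + c. *)
Definition pcf_variety03 (A : comNzRingType) (a b c : A) : set (A * A * A) :=
  [set x | let E := Dmx x.1.1 *m Dmx x.1.2 *m Dmx x.2 in
    [/\ a * (E 1 1 - E 0 0) = b * E 1 0,
        - (a * E 0 1) = c * E 1 0 &
        - (b * E 0 1) = c * (E 1 1 - E 0 0)]].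

Definition V2_03 (A : comNzRingType) : set (A * A * A) :=
  pcf_variety03 1 0 (- 2).

Arguments V2_03 : clear implicits.

(* P^1(C) as the Riemann sphere: [x : y] is Some (x / y) if y != 0 and is the
   point at infinity None otherwise.  The convergents have (x, y) != (0, 0),
   since det (Dmx c) = -1. *)
Definition P1C (R : realType) := one_point_compactification R[i]^o.

Definition P1C_frac (R : realType) (x y : R[i]) : P1C R :=
  if y == 0 then None else Some (x / y).

Definition convergent (R : realType) (c : nat -> R[i]) (n : nat) : P1C R :=
  P1C_frac (cf_mx c n 0 0) (cf_mx c n 1 0).

Definition cf_has_value (R : realType) (c : nat -> R[i]) (z : P1C R) : Prop :=
  convergent c n @[n --> \oo] --> z.

Definition sqrt2C (R : realType) : P1C R := Some (Num.sqrt (2 : R))%:C.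

Definition Zcf_is_sqrt2 (R : realType) (c : nat -> int) : Prop :=
  cf_has_value (fun n => (c n)%:~R : R[i]) (sqrt2C R).

(* c' arises from c by applying [..., a, 0, b, ...] = [..., a + b, ...]
   simultaneously to a (possibly infinite) family of disjoint blocks a, 0, b
   of c; s n is the position in c at which the term c' n, or the block that
   it replaces, begins. *)
Definition zero_contraction (A : nmodType) (c c' : nat -> A) : Prop :=
  exists2 s : nat -> nat, s 0%N = 0%N &
    forall n,
      (s n.+1 = (s n).+1 /\ c' n = c (s n)) \/
      [/\ s n.+1 = (s n).+3, c (s n).+1 = 0 & c' n = c (s n) + c (s n).+2].

Lemma V2_03E (x1 x2 x3 : int) :
  V2_03 int (x1, x2, x3) <->
  x2 - x1 * x2 * x3 - x1 - x3 = 0 /\ - (x1 * x2) - 1 = - 2 * (x2 * x3 + 1).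
Proof.
rewrite /V2_03 /pcf_variety03 /=.
rewrite !mxE !big_ord_recr !big_ord0 /= !mxE !big_ord_recr !big_ord0 /= !mxE /=.
rewrite !(mul0r, mulr0, mul1r, mulr1, add0r, addr0, oppr0).
split=> [[h1 h2 h3]|[h1 h2]].
- split; first by rewrite -[RHS]h1; ring.
  by transitivity (- (x1 * x2 + 1)); [ring|rewrite h2].
- have h : x2 - (x1 * x2 + 1) * x3 - x1 = 0 by rewrite -[RHS]h1; ring.
  split.
  + by rewrite -[RHS]h1; ring.
  + by rewrite -h2; ring.
  + by transitivity (- 2 * (x2 - x1 * x2 * x3 - x1 - x3)); [rewrite h1 mulr0|ring].
Qed.

Lemma Dmx_contract (A : comNzRingType) (a b : A) :
  Dmx a *m Dmx 0 *m Dmx b = Dmx (a + b).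
Proof.
apply/matrixP => i j.
rewrite !mxE !big_ord_recr !big_ord0 /= !mxE !big_ord_recr !big_ord0 /= !mxE.
by case: i => [[|[|//]] ?]; case: j => [[|[|//]] ?] /=;
   rewrite !(mul0r, mulr0, mul1r, mulr1, add0r, addr0) // addrC.
Qed.

Lemma zero_contraction_value (R : realType) (c c' : nat -> R[i]) (z : P1C R) :
  zero_contraction c c' -> cf_has_value c z -> cf_has_value c' z.
Proof.
case=> s s0 hs cz.
have prodE n : cf_mx c' n = cf_mx c (s n).
  elim: n => [|n IHn]; first by rewrite s0 /cf_mx !big_ord0.
  rewrite [LHS]/cf_mx big_ord_recr /= -/(cf_mx c' n) IHn.
  case: (hs n) => [[-> ->]|[-> c0 ->]].
    by rewrite [RHS]/cf_mx big_ord_recr.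
  by rewrite [RHS]/cf_mx !big_ord_recr /= c0 -!mulrA -Dmx_contract -mulmxA.
have sn n : (n <= s n)%N.
  elim: n => [//|n IHn].
  by case: (hs n) => [[-> _]|[-> _ _]] //; rewrite ltnS // ltnW // ltnW.
move=> U /cz [N _ NU]; exists N => // n Nn /=.
rewrite /convergent prodE; apply: (NU (s n)) => /=.
exact: leq_trans Nn (sn n).
Qed.

(* Main.v *)
Require Import Defs.
From mathcomp Require Import all_boot all_order all_algebra.
From mathcomp Require Import all_classical all_reals all_analysis.
From mathcomp Require Import finmap complex ring lra zify.

Import Order.TTheory GRing.Theory Num.Theory numFieldNormedType.Exports.

Local Open Scope classical_set_scope.
Local Open Scope ring_scope.
Local Open Scope card_scope.

(* Eliminating between the two equations of the variety gives
   x2 (x1 - 2 x3) = 1, so x2 = 1 or -1 and a quadratic in x3 remains.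

   For [\overline{a1, a2, a3}] write the convergents p_n / q_n with p_n, q_n
   integers, and E = D(a1) D(a2) D(a3).  Since (p_{n+3}, q_{n+3}) is
   E (p_n, q_n), a finite limit is fixed by the homography of E; for the limit
   sqrt 2 the fixed-point equation splits, sqrt 2 being irrational, into the
   two equations of the variety.  For (1, 1, 0) and (3, -1, 2) the matrix E is
   [[1, 2], [1, 1]] up to sign, which negates p^2 - 2 q^2; this form thus stays
   bounded along the convergents while |q_n| grows, whence p_n / q_n tends to
   sqrt 2.  For the two opposite points p_n q_n <= 0, which excludes sqrt 2. *)

(** * Integer points of the variety *)

Lemma card_set_seq (T : choiceType) (s : seq T) :
  uniq s -> [set` s] #= `I_(size s).
Proof.
move=> us; have -> : [set` s] = [set` [fset x in s]%fset].
  by apply/predeqP => x /=; rewrite !inE.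
by apply/card_eq_fsetP; rewrite card_fseq undup_id.
Qed.

Lemma mem_V2_03 (x : int * int * int) :
  V2_03 int x <->
  x \in [:: (1, 1, 0); (- 1, - 1, 0); (3, - 1, 2); (- 3, 1, - 2)].
Proof.
case: x => -[x1 x2] x3; rewrite V2_03E; split; last first.
  by rewrite !inE => /or4P[] /eqP[-> -> ->].
case=> h1 h2.
have h : x2 * (x1 - 2 * x3) = 1 by nia.
have /eqP := congr1 absz h; rewrite abszM muln_eq1 => /andP[/eqP x2E _].
have [e|e] : x2 = 1 \/ x2 = - 1 by lia.
all: subst x2.
- have ? : x1 = 2 * x3 + 1 by lia.
  subst x1; have : x3 * (x3 + 2) = 0 by nia.
  move/eqP; rewrite mulf_eq0 addr_eq0 => /orP[]/eqP-> //.
- have ? : x1 = 2 * x3 - 1 by lia.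
  subst x1; have : x3 * (x3 - 2) = 0 by nia.
  move/eqP; rewrite mulf_eq0 subr_eq0 => /orP[]/eqP-> //.
Qed.

(** Squaring gives [a ^ 2 = 2 * b ^ 2], whose 2-adic valuation is even on the left and odd on the
    right unless [b = 0]. *)
Lemma sqrt2_irrational (R : realType) (a b : int) :
  a%:~R = b%:~R * Num.sqrt 2 :> R -> a = 0 /\ b = 0.
Proof.
move=> ab.
have sq : a ^+ 2 = 2 * b ^+ 2.
  apply: (@intr_inj R); rewrite rmorphXn /= ab exprMn.
  by rewrite sqr_sqrtr ?ler0n// mulrC [RHS]rmorphM rmorphXn.
have sqn : (`|a| ^ 2 = 2 * `|b| ^ 2)%N by nia.
have b0 : b = 0.
  apply: contra_eq sqn => bn0.
  have an0 : (0 < `|a|)%N by nia.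
  apply/eqP => /(congr1 (fun n => odd (logn 2 n))).
  by rewrite lognM ?expn_gt0 ?absz_gt0 ?bn0// !lognX !mul2n oddD !odd_double
    logn_prime.
by split=> //; nia.
Qed.

(** * From the Riemann sphere to real fractions *)

Lemma cf_mx_intr (A : comNzRingType) (c : nat -> int) (n : nat) :
  cf_mx (fun k => (c k)%:~R : A) n = map_mx intr (cf_mx c n).
Proof.
rewrite /cf_mx; elim: n => [|n IHn]; first by rewrite !big_ord0 map_mx1.
rewrite !big_ord_recr /= IHn map_mxM; congr (_ *m _).
apply/matrixP => j k; rewrite !mxE.
by case: ifP => _ //; case: eqP.
Qed.

Lemma normc_real (R : rcfType) (x : R) : `|x%:C%C| = `|x|%:C%C.
Proof. by rewrite normc_def /= expr0n addr0 sqrtr_sqr. Qed.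

Lemma convergent_intr (R : realType) (c : nat -> int) (n : nat) :
  convergent (fun k => (c k)%:~R : R[i]) n =
  if cf_mx c n 1 0 == 0 then None
  else Some ((cf_mx c n 0 0)%:~R / (cf_mx c n 1 0)%:~R : R)%:C%C.
Proof.
rewrite /convergent /P1C_frac cf_mx_intr !mxE intr_eq0; case: ifP => // _.
by congr Some; rewrite rmorphM fmorphV !rmorph_int.
Qed.

(** The nonvanishing of denominators is a separate conjunct because a real quotient by [0] is [0],
    whereas such a convergent is the point at infinity. *)
Lemma Zcf_is_sqrt2P (R : realType) (c : nat -> int) :
  Zcf_is_sqrt2 R c <->
  (\forall n \near \oo, cf_mx c n 1 0 != 0) /\
  (cf_mx c n 0 0)%:~R / (cf_mx c n 1 0)%:~R @[n --> \oo] --> Num.sqrt (2 : R).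
Proof.
rewrite /Zcf_is_sqrt2 /cf_has_value /sqrt2C; split.
  move=> h; split.
    (* The finite points form a neighbourhood of the limit, so the convergents eventually avoid
       [None]. *)
    have := h _ (@one_point_compactification_some_nbhs R[i]^o _ _ filterT).
    move=> [N _ HN]; exists N => // n /HN /= [z _].
    by rewrite convergent_intr; case: eqP.
  apply/cvgrPdist_lt => e e0.
  have e0' : 0 < e%:C%C by rewrite ltcR.
  have := h _ (@one_point_compactification_some_nbhs R[i]^o _ _
                 (nbhsx_ballx _ _ e0')).
  move=> [N _ HN]; exists N => // n /HN /= [z].
  rewrite convergent_intr; case: eqP => // _ + [zE]; rewrite {}zE.
  by rewrite -ball_normE /ball_ /= -rmorphB /= normc_real ltcR.
move=> [[N _ hN] h] U; rewrite /= {1}/nbhs /= => hU.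
have [e /= e0 eU] := (nbhs_ballP (_ : R[i]^o) _).1 hU.
have [e0' eE] : 0 < complex.Re e /\ e = (complex.Re e)%:C%C.
  by case: e e0 {eU} => a b; rewrite ltcE /= => /andP[/eqP -> ->].
move/cvgrPdist_lt : h => /(_ _ e0') [M _ hM].
exists (maxn N M) => // n /=; rewrite geq_max => /andP[Nn Mn].
rewrite convergent_intr (negbTE (hN _ Nn)).
apply: (eU); rewrite -ball_normE /ball_ /= -rmorphB /= normc_real eE ltcR.
exact: hM.
Qed.

(** * Recursion over one period and the fixed-point equation *)

Lemma mulmx2E (A : comNzRingType) (M N : 'M[A]_2) (i j : 'I_2) :
  (M *m N) i j = M i 0 * N 0 j + M i 1 * N 1 j.
Proof.
by rewrite mxE big_ord_recl big_ord1 (_ : lift _ _ = 1) //; exact: val_inj.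
Qed.

Lemma cf_mx_pcf3 (a1 a2 a3 : int) (n : nat) :
  cf_mx (pcf [::] [:: a1; a2; a3]) n.+3 =
  Dmx a1 *m Dmx a2 *m Dmx a3 *m cf_mx (pcf [::] [:: a1; a2; a3]) n.
Proof.
rewrite /cf_mx !big_ord_recl /= !mulrA; congr (_ * _).
apply: eq_bigr => i _; congr Dmx; rewrite /pcf /= !subn0 /bump /=.
by rewrite !add1n -addn3 modnDr.
Qed.

Section Period3.
Context (a1 a2 a3 : int).
Let c := pcf [::] [:: a1; a2; a3].
Let p n := cf_mx c n 0 0.
Let q n := cf_mx c n 1 0.

Lemma cf_num_pcf3 n :
  p n.+3 = (a1 * a2 * a3 + a1 + a3) * p n + (a1 * a2 + 1) * q n.
Proof.
by rewrite /p /q cf_mx_pcf3 !(mulmx2E, mxE) /=; ring.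
Qed.

Lemma cf_den_pcf3 n : q n.+3 = (a2 * a3 + 1) * p n + a2 * q n.
Proof.
by rewrite /p /q cf_mx_pcf3 !(mulmx2E, mxE) /=; ring.
Qed.

(** Induction with step 3 from the convergents of index 0, 1 and 2. Invariants of the pair
    [(p n, q n)] can thus be proved without matrices. *)
Lemma pcf3_ind (P : nat -> int -> int -> Prop) :
  P 0 1 0 -> P 1 a1 1 -> P 2 (a1 * a2 + 1) a2 ->
  (forall n x y, P n x y -> P n.+3
     ((a1 * a2 * a3 + a1 + a3) * x + (a1 * a2 + 1) * y)
     ((a2 * a3 + 1) * x + a2 * y)) ->
  forall n, P n (p n) (q n).
Proof.
move=> P0 P1 P2 PS n.
suff [] : [/\ P n (p n) (q n), P n.+1 (p n.+1) (q n.+1) &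
    P n.+2 (p n.+2) (q n.+2)] by [].
elim: n => [|n [h0 h1 h2]]; last first.
  by split=> //; rewrite cf_num_pcf3 cf_den_pcf3; exact: PS.
have c0 : c 0 = a1 by [].
have c1 : c 1 = a2 by [].
rewrite /p /q /cf_mx !big_ord_recr !big_ord0 /= c0 c1 !mul1r.
rewrite -[Dmx a1 * _]/(Dmx a1 *m _) !(mulmx2E, mxE) /=.
by rewrite !(mulr1, mul1r, mulr0, mul0r, addr0, add0r).
Qed.

Lemma Zcf_is_sqrt2_V2_03 (R : realType) :
  Zcf_is_sqrt2 R c -> V2_03 int (a1, a2, a3).
Proof.
move=> /Zcf_is_sqrt2P [[N _ qN0]]; rewrite -/p -/q => xs.
pose x n : R := (p n)%:~R / (q n)%:~R.
have {}xs : x n @[n --> \oo] --> Num.sqrt 2 by [].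
pose e : int := a1 * a2 * a3 + a1 + a3; pose f : int := a1 * a2 + 1.
pose g : int := a2 * a3 + 1.
have q0 n : (N <= n)%N -> (q n)%:~R != 0 :> R by rewrite intr_eq0; exact: qN0.
have xq n : (N <= n)%N -> x n * (q n)%:~R = (p n)%:~R.
  by move=> /q0 qn0; rewrite /x divfK.
clearbody x.
(* The homography is written without division, so that it passes to the limit even if [g * x n + a2]
   tends to [0]. *)
have xE n : (N <= n)%N -> x (n + 3)%N * (g%:~R * x n + a2%:~R) =
    e%:~R * x n + f%:~R.
  move=> Nn; have Nn3 : (N <= n + 3)%N by rewrite (leq_trans Nn)// leq_addr.
  have dE : (q (n + 3)%N)%:~R = g%:~R * (p n)%:~R + a2%:~R * (q n)%:~R :> R.
    by rewrite addn3 cf_den_pcf3 rmorphD !rmorphM.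
  have nE : (p (n + 3)%N)%:~R = e%:~R * (p n)%:~R + f%:~R * (q n)%:~R :> R.
    by rewrite addn3 cf_num_pcf3 rmorphD !rmorphM.
  apply: (mulIf (q0 n Nn)).
  by rewrite -mulrA !mulrDl -!mulrA !xq// -dE -nE xq.
have lhs : x (n + 3)%N * (g%:~R * x n + a2%:~R) @[n --> \oo] -->
    Num.sqrt 2 * (g%:~R * Num.sqrt 2 + a2%:~R).
  apply: cvgM; first by rewrite (cvg_shiftn 3 x).
  by apply: cvgD; [apply: cvgMl_tmp|apply: cvg_cst].
have rhs : x (n + 3)%N * (g%:~R * x n + a2%:~R) @[n --> \oo] -->
    e%:~R * Num.sqrt 2 + f%:~R.
  have : e%:~R * x n + f%:~R @[n --> \oo] --> e%:~R * Num.sqrt 2 + f%:~R.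
    by apply: cvgD; [apply: cvgMl_tmp|apply: cvg_cst].
  by apply: cvg_trans; apply: near_eq_cvg; exists N => // n /= /xE.
have := cvg_unique (@Rhausdorff R) lhs rhs => /(_ _).
rewrite mulrDr mulrCA -expr2 sqr_sqrtr ?ler0n// => fixed.
(* [fixed] amounts to [2 g - f = (e - a2) sqrt 2]; the equations of the variety are [f = 2 g] and
   [e = a2]. *)
have [|h1 h2] := @sqrt2_irrational R (2 * g - f) (e - a2).
  by rewrite intrB [LHS]intrB intrM -[2%:~R]/2%:R; lra.
by apply/V2_03E; split; rewrite /e /f /g in h1 h2; lia.
Qed.

End Period3.

(** * Convergence or divergence from [sqrt 2] at the four points *)

Lemma Zcf_is_sqrt2_pos (R : realType) (c : nat -> int) :
  Zcf_is_sqrt2 R c -> exists n, 0 < cf_mx c n 0 0 * cf_mx c n 1 0.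
Proof.
move=> /Zcf_is_sqrt2P [_ xs].
have s0 : 0 < Num.sqrt 2 :> R by rewrite sqrtr_gt0 ltr0n.
have : \forall n \near \oo,
    0 < (cf_mx c n 0 0)%:~R / (cf_mx c n 1 0)%:~R :> R
  by exact: cvgr_gt xs _ s0.
case=> N _ /(_ N (leqnn N)) /= xN.
exists N; rewrite -(ltr0z R) rmorphM /=.
(* Since [0^-1 = 0], a zero denominator would make the quotient [0], against [xN]. *)
have q0 : (cf_mx c N 1 0)%:~R != 0 :> R.
  by apply: contraTneq xN => ->; rewrite invr0 mulr0 ltxx.
rewrite -[X in X * _](divfK q0) -(mulrA (_ / _)) -expr2.
by rewrite pmulr_rgt0// exprn_even_gt0.
Qed.

(** The sign condition selects [sqrt 2] rather than [- sqrt 2]; the last bound makes [|q n|]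
    grow. *)
Lemma cvg_frac_sqrt2 (R : realType) (p q : nat -> int) (C : int) :
  (forall n, [/\ 0 <= p n * q n, `|p n ^+ 2 - 2 * q n ^+ 2| <= C &
    (n <= 3 * `|q n| + 2)%N]) ->
  (p n)%:~R / (q n)%:~R @[n --> \oo] --> Num.sqrt (2 : R).
Proof.
move=> h; apply/cvgrPdist_lt => e e0.
(* An error of at least [e] would force [e * q^2 <= C], as [p / q + sqrt 2 >= 1]; with
   [n <= 3 * q^2 + 2] this bounds [n] by the chosen threshold. Taking [n >= 3] ensures
   [q n != 0]. *)
have [N _ hN] := nbhs_infty_gtr (3 * C%:~R / e + 2).
exists (maxn N 3) => // n /=; rewrite geq_max => /andP[/hN /= {}hN n3].
case: (h n) => pq0 Cn qn.
set P : R := (p n)%:~R; set Q : R := (q n)%:~R; set s := Num.sqrt _.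
have s2 : s ^+ 2 = 2 by rewrite sqr_sqrtr ?ler0n.
have s1 : 1 <= s by rewrite -sqrtr1 ler_wsqrtr// ler1n.
have Q0 : Q != 0 by rewrite intr_eq0; lia.
have Q2 : 0 < Q ^+ 2 by rewrite exprn_even_gt0.
have x0 : 0 <= P / Q.
  rewrite -(pmulr_lge0 _ Q2) expr2 mulrA divfK//.
  by rewrite -rmorphM ler0z.
(* |s - x| (x + s) q^2 = |p^2 - 2 q^2| where x = p / q *)
have dist : `|s - P / Q| * (P / Q + s) * Q ^+ 2 <= C%:~R.
  rewrite -[P / Q + s]ger0_norm ?addr_ge0 ?sqrtr_ge0//.
  rewrite -[Q ^+ 2]ger0_norm ?(ltW Q2)// -!normrM.
  rewrite [X in `|X|](_ : _ = - (P ^+ 2 - s ^+ 2 * Q ^+ 2)); last by field.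
  rewrite normrN s2 -!rmorphXn -[2]/(2%:~R) -rmorphM -rmorphB /=.
  by rewrite -intr_norm ler_int.
have nQ : n%:R <= 3 * Q ^+ 2 + 2.
  have : n%:Z <= 3 * q n ^+ 2 + 2 by nia.
  by rewrite -(ler_int R) rmorphD rmorphM rmorphXn.
rewrite ltNge; apply/negP => le_e.
have eQ : e * Q ^+ 2 <= C%:~R.
  apply: le_trans dist; rewrite ler_pM2r//; apply: le_trans le_e _.
  by rewrite ler_peMr// ler_wpDl.
have : 3 * C%:~R / e < 3 * Q ^+ 2 by lra.
by rewrite ltr_pdivrMr// -mulrA ltr_pM2l// ltNge [_ * e]mulrC eQ.
Qed.

Lemma Zcf_is_sqrt2_period3 (R : realType) (a1 a2 a3 : int) :
  (a1, a2, a3) \in [:: (1, 1, 0); (3, - 1, 2)] ->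
  Zcf_is_sqrt2 R (pcf [::] [:: a1; a2; a3]).
Proof.
move=> ha.
(* The strict sign of [x] makes [|y|] increase by at least 1 per period. The bound 7 is
   [3^2 - 2 * 1^2], attained at index 1 for [(3, -1, 2)]. *)
pose P (n : nat) (x y : int) :=
  [/\ 1 <= x /\ 0 <= y \/ x <= - 1 /\ y <= 0, `|x ^+ 2 - 2 * y ^+ 2| <= 7 &
    (n <= 3 * `|y| + 2)%N].
have inv : forall n, P n (cf_mx (pcf [::] [:: a1; a2; a3]) n 0 0)
    (cf_mx (pcf [::] [:: a1; a2; a3]) n 1 0).
  have step n x y : P n x y -> P n.+3 (x + 2 * y) (x + y).
    case=> xy Q ny; split; [lia| |lia].
    suff -> : (x + 2 * y) ^+ 2 - 2 * (x + y) ^+ 2 = - (x ^+ 2 - 2 * y ^+ 2).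
      by rewrite normrN.
    by ring.
  (* For [(3, -1, 2)] the period matrix carries the minus sign. *)
  have stepN n x y : P n x y -> P n (- x) (- y).
    by case=> xy Q ny; split; [lia|rewrite !sqrrN|lia].
  move: ha; rewrite !inE => /orP[]/eqP[-> -> ->]; apply: pcf3_ind.
  all: try by rewrite /P; split => //; lia.
  - move=> n x y /step; congr P; ring.
  - move=> n x y /step /stepN; congr P; ring.
apply/Zcf_is_sqrt2P; split.
  exists 3%N => // n /= n3; have [_ _] := inv n.
  by move: (cf_mx _ n 1 0) => y; lia.
apply: (@cvg_frac_sqrt2 R (fun n => cf_mx _ n 0 0) (fun n => cf_mx _ n 1 0) 7).
move=> n; have := inv n; move: (cf_mx _ n 0 0) (cf_mx _ n 1 0) => x y [xy Q ny].
by split=> //; nia.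
Qed.

Lemma Zcf_is_sqrt2_period3N (R : realType) (a1 a2 a3 : int) :
  (a1, a2, a3) \in [:: (- 1, - 1, 0); (- 3, 1, - 2)] ->
  ~ Zcf_is_sqrt2 R (pcf [::] [:: a1; a2; a3]).
Proof.
move=> ha /Zcf_is_sqrt2_pos [n]; apply/negP; rewrite -leNgt.
(* Up to sign a period sends [(x, y)] to [(x - 2 y, y - x)], with product
   [- x^2 + 3 x y - 2 y^2]. *)
move: ha n; rewrite !inE => /orP[]/eqP[-> -> ->];
  by apply: (@pcf3_ind _ _ _ (fun _ x y => x * y <= 0)) => // _ x y; nia.
Qed.

(** * Contraction to the classical expansion *)

Lemma zero_contraction_110 :
  zero_contraction (pcf [::] [:: 1; 1; 0] : nat -> int) (pcf [:: 1] [:: 2]).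
Proof.
(* The initial [1] is kept; each later block [1, 0, 1] starts at a position [3 m + 1] and becomes
   [2]. *)
exists (fun n => if n is m.+1 then (3 * m + 1)%N else 0) => // -[|n].
  by left.
have E k : pcf [::] [:: 1; 1; 0] (3 * n + k) = [:: 1; 1; 0]`_(k %% 3) :> int.
  by rewrite /pcf /= subn0 mulnC modnMDl.
right; split; first by lia.
- by rewrite -addnS E.
- by rewrite -!addnS !E /pcf /= modn1.
Qed.

Theorem proposition6p6 (R : realType) :
  (let P := V2_03 int in
   P #= `I_4 /\
   P = [set (1, 1, 0); (- 1, - 1, 0); (3, - 1, 2); (- 3, 1, - 2)]) /\
  (let S := [set a : int * int * int |
      Zcf_is_sqrt2 R (pcf [::] [:: a.1.1; a.1.2; a.2])] in
   [/\ S #= `I_2,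
       S = [set (3, - 1, 2); (1, 1, 0)],
       Zcf_is_sqrt2 R (pcf [:: 1] [:: 2]) &
       zero_contraction (pcf [::] [:: 1; 1; 0] : nat -> int)
                        (pcf [:: 1] [:: 2])]).
Proof.
have VE : V2_03 int =
    [set` [:: (1, 1, 0); (- 1, - 1, 0); (3, - 1, 2); (- 3, 1, - 2)]].
  by apply/predeqP => x; exact: mem_V2_03.
have SE : [set a : int * int * int |
      Zcf_is_sqrt2 R (pcf [::] [:: a.1.1; a.1.2; a.2])] =
    [set` [:: (3, - 1, 2); (1, 1, 0)]].
  apply/predeqP => -[[a1 a2] a3] /=; split; last first.
    by move=> h; apply: Zcf_is_sqrt2_period3; rewrite !inE orbC in h *.
  move=> h; have /mem_V2_03 := Zcf_is_sqrt2_V2_03 _ _ _ _ h.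
  have : (a1, a2, a3) \notin [:: (- 1, - 1, 0); (- 3, 1, - 2)].
    by apply/negP => /Zcf_is_sqrt2_period3N /(_ h).
  rewrite !inE !negb_or => /andP[/negbTE-> /negbTE->].
  by rewrite orbF orbC.
split=> /=.
  split; first by rewrite VE; exact: card_set_seq.
  by rewrite VE; apply/predeqP => x /=; rewrite !inE; split;
    [move=> /or4P[]/eqP->; tauto|case=> [[[]|]|] ->; rewrite eqxx ?orbT].
split; last exact: zero_contraction_110.
- by rewrite SE; exact: card_set_seq.
- by rewrite SE; apply/predeqP => x /=; rewrite !inE; split;
    [move=> /orP[]/eqP->; tauto|case=> ->; rewrite eqxx ?orbT].
(* The same [s] witnesses the contraction after the cast from [int] to [R[i]], which preserves [0]
   and sums. *)
- have [s s0 hs] := zero_contraction_110.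
  apply: (@zero_contraction_value _
    (fun n => (pcf [::] [:: 1; 1; 0] n : int)%:~R)); last first.
    exact: Zcf_is_sqrt2_period3.
  exists s => // n; case: (hs n) => [[-> ->]|[-> h0 ->]]; [by left|right].
  by rewrite h0 rmorphD.
Qed.
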